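(* Let $(X,d)$ be a Hadamard space and let $\phi:X\to(-\infty,+\infty]$ be a convex lower-semicontinuous function with gradient flow semigroup $(S_t)_{t\geq0}$. Let $y\in\operatorname{argmin}\phi$, $x\in\mathrm{dom}\,\phi$ and let $b\in\mathbb{N}$, $b\geq1$, with $d(x,y)\leq b$. Let $\mu:=\min_{u\in X}\phi(u)$ and $X_0:=\overline{B}_b(y)\cap\overline{\mathrm{dom}\,\phi}$, and let $F:X\to[0,+\infty]$ be given by $F(z):=\phi(z)-\mu$ if $z\in X_0$ and $F(z):=+\infty$ otherwise. Assume that $F$ has a modulus of regularity $\tau$ w.r.t. $\overline{B}_b(y)$. Then, with $\rho(\varepsilon):=\lceil b^2/\tau(\varepsilon)\rceil+1$: \[ \forall\varepsilon>0\ \forall t\geq\rho(\varepsilon)\ (\mathrm{dist}(S_t(x),\operatorname{argmin}\phi)<\varepsilon)\quad\text{and}\quad\forall\varepsilon>0\ \forall t,s\geq\rho(\varepsilon/2)\ (d(S_t(x),S_s(x))<\varepsilon). \] In particular, $S_t(x)$ converges as $t\to\infty$ to a minimizer $x^*$ of $\phi$ with that rate, i.e. $d(S_t(x),x^* )\leq\varepsilon$ for all $\varepsilon>0$ and $t\geq\rho(\varepsilon/2)$.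
   Context: $\mathbb{N}$ contains $0$. A Hadamard space is a complete geodesic metric space of nonpositive curvature in the sense of Alexandrov (complete CAT(0) space). $\mathrm{dom}\,\phi:=\{x\in X\mid\phi(x)<+\infty\}$; $\overline{B}_b(y)$ is the closed ball. The resolvent of $\phi$ is $J_t(x):=\operatorname{argmin}_{u\in X}\left(\phi(u)+\frac{1}{2t}d^2(x,u)\right)$ for $t>0$ and $J_0(x):=x$; the gradient flow semigroup is $S_t(x):=\lim_{n\to\infty}(J_{t/n})^{(n)}(x)$ for $t\geq0$, $x\in\overline{\mathrm{dom}\,\phi}$, where $(\cdot)^{(n)}$ denotes $n$-fold iteration (this limit exists). With $\mathrm{zer}F:=\{z\in X\mid F(z)=0\}$ (here equal to $\operatorname{argmin}\phi\cap X_0$), a modulus of regularity for $F$ w.r.t. $\overline{B}_b(y)$ is a function $\tau:(0,\infty)\to(0,\infty)$ such that for all $\varepsilon>0$ and all $u\in\overline{B}_b(y)$: $F(u)<\tau(\varepsilon)$ implies $\mathrm{dist}(u,\mathrm{zer}F)<\varepsilon$. *)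

(* Defs.v *)
From HB Require Import structures.
From mathcomp Require Import all_boot all_order all_algebra.
From mathcomp Require Import all_classical all_reals all_analysis.

Set Implicit Arguments.
Unset Strict Implicit.
Unset Printing Implicit Defensive.

Import Order.TTheory GRing.Theory Num.Theory.
Import numFieldNormedType.Exports.

Local Open Scope classical_set_scope.
Local Open Scope ring_scope.

#[short(type="completeMetricType")]
HB.structure Definition CompleteMetric (R : numDomainType) :=
  {M of Metric R M & Complete M}.

Section hadamard.
Context {R : realType} {X : metricType R}.
Implicit Types (c : R -> X) (p q r : X).

(* [c] is a constant-speed geodesic from [p] to [q], parametrized by [0, 1];
   its values outside [0, 1] are irrelevant. *)
Definition geodesic c p q :=
  [/\ c 0 = p, c 1 = q &
      forall s t : R, 0 <= s <= 1 -> 0 <= t <= 1 ->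
        mdist (c s) (c t) = `|s - t| * mdist p q].

Definition geodesic_space := forall p q, exists c, geodesic c p q.

(* The norm of the library on ['rV[R]_2] is the sup norm. *)
Definition euclid_dist (u v : 'rV[R]_2) : R :=
  Num.sqrt (\sum_(i < 2) (u ord0 i - v ord0 i) ^+ 2).

(* Comparison with Euclidean triangles. Any two sides share a vertex, so up to relabelling it is
   enough to compare points of the sides issued from [p]. *)
Definition cat0 := forall p q r cpq cpr cqr,
  geodesic cpq p q -> geodesic cpr p r -> geodesic cqr q r ->
  forall p' q' r' : 'rV[R]_2,
  euclid_dist p' q' = mdist p q ->
  euclid_dist p' r' = mdist p r ->
  euclid_dist q' r' = mdist q r ->
  forall s t : R, 0 <= s <= 1 -> 0 <= t <= 1 ->
  mdist (cpq s) (cpr t) <=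
    euclid_dist ((1 - s) *: p' + s *: q') ((1 - t) *: p' + t *: r').

End hadamard.

Definition hadamard_space (R : realType) (X : completeMetricType R) :=
  @geodesic_space R X /\ @cat0 R X.

Section metric.
Context {R : realType} {X : metricType R}.
Implicit Types (phi F : X -> \bar R) (A : set X).

(* The library's [closed_ball] is the closure of the open ball. *)
Definition cball (y : X) (r : R) : set X := [set u | mdist y u <= r].

(* Extended-real valued: [dist_set u set0 = +oo]. *)
Definition dist_set (u : X) A : \bar R :=
  ereal_inf [set (mdist u z)%:E | z in A].

Definition edom phi : set X := [set u | (phi u < +oo)%E].

Definition argmin phi : set X := [set z | forall u, (phi z <= phi u)%E].

Definition convex_fun phi := forall p q c, geodesic c p q ->
  forall t : R, 0 <= t <= 1 ->
  (phi (c t) <= (1 - t)%:E * phi p + t%:E * phi q)%E.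

Definition zer F : set X := [set z | F z = 0%E].

Definition modulus_of_regularity F A (tau : R -> R) :=
  (forall e : R, 0 < e -> 0 < tau e) /\
  (forall (e : R) u, 0 < e -> A u ->
     (F u < (tau e)%:E)%E -> (dist_set u (zer F) < e%:E)%E).

Definition restricted_gap phi (y : X) (b : R) (z : X) : \bar R :=
  if z \in cball y b `&` closure (edom phi)
  then (phi z - ereal_inf (range phi))%E else +oo%E.

End metric.

Section gradient_flow.
Context {R : realType} {X : completeMetricType R}.
Implicit Types (phi : X -> \bar R).

(* [get] selects the minimizer, which is unique when [X] is Hadamard and [phi]
   is proper, convex and lower semicontinuous. *)
Definition resolvent phi (t : R) (x : X) : X :=
  if 0 < t
  then get (argmin (fun u => phi u + ((2 * t)^-1 * mdist x u ^+ 2)%:E)%E)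
  else x.

Definition gradient_flow phi (t : R) (x : X) : X :=
  lim (iter n (resolvent phi (t / n%:R)) x @[n --> \oo]).

End gradient_flow.

Definition rate (R : realType) (b : R) (tau : R -> R) (e : R) : R :=
  (Num.ceil (b ^+ 2 / tau e))%:~R + 1.

(* Main.v *)
Require Import Defs.
From mathcomp Require Import all_boot all_order all_algebra.
From mathcomp Require Import all_classical all_reals all_analysis.
From mathcomp Require Import ring lra.
Import Order.TTheory GRing.Theory Num.Theory.
Import numFieldNormedType.Exports.
Local Open Scope classical_set_scope.
Local Open Scope ring_scope.

(** Everything rests on one inequality for the resolvent. Squared distances in
    a CAT(0) space are strongly convex along geodesics ([hadamard_cn]), hence
    so is [u |-> phi u + d(x, u)^2 / 2l]: this function has a minimizer
    [u = J_l x], and comparing [u] with points of the geodesic from [u] to [v]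
    close to [u] gives the discrete evolution variational inequality
    ([resolvent_evi])
      [d(u, v)^2 + d(x, u)^2 + 2 l (phi u - phi v) <= d(x, v)^2].

    Taking [v] a minimizer shows that iterating [J_l] never increases the
    distance to [v] and that after time [t = n l] the gap of [phi] to its
    minimum is at most [d(x, v)^2 / 2t].

    The existence of the flow also follows. For [x_i = J_l^i x] and
    [y_j = J_m^j x], the inequality for [x_i] tested at [y_j] and the one for
    [y_j] tested at [x_i] combine so that [phi] disappears, and
    [a_ij = d(x_i, y_j)^2] satisfies the Crandall-Liggett recursion
      [(l + m) a_(i+1)(j+1) <= m a_i(j+1) + l a_(i+1)j].
    Since [x] is in the domain and [phi] is bounded below by some [mu],
    [a_i0 <= C i l] and [a_0j <= C j m] for [C = 2 (phi x - mu)]. Kobayashi's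
    function [sqrt ((i l - j m)^2 + i l^2 + j m^2)] is a supersolution of this
    recursion ([kobayashi_bound]), so [a_ij] is at most [C] times it. With
    [i l = j m = t] this makes [J_(t/n)^n x] a Cauchy sequence
    ([gradient_flow_cvg]). With [i l] within [l] of a smaller time [s] and
    [j m = s] it shows that the scheme aiming at time [t] passes close to the
    flow at time [s], whence the distance from the flow to a minimizer is
    nonincreasing in time ([gradient_flow_fejer]); the semigroup law is
    bypassed.

    For [t >= rho e] the gap at [S_t x] is below [tau e], so the modulus of
    regularity yields a minimizer within [e] of [S_t x]. If that minimizer [z]
    is taken within [e / 2] of the flow at time [rho (e / 2)], monotonicity of
    the distance to [z] keeps all later points within [e / 2] of [z], hence
    within [e] of each other. Completeness and lower semicontinuity conclude. *)

Set Implicit Arguments.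
Unset Strict Implicit.
Unset Printing Implicit Defensive.

(** * Strong convexity of the squared distance *)

Section euclidean_plane.
Context {R : realType}.

Lemma euclid_dist_sqr (u v : 'rV[R]_2) :
  euclid_dist u v ^+ 2 =
  (u ord0 ord0 - v ord0 ord0) ^+ 2 + (u ord0 ord_max - v ord0 ord_max) ^+ 2.
Proof.
rewrite /euclid_dist sqr_sqrtr; last by apply: sumr_ge0 => i _; exact: sqr_ge0.
rewrite big_ord_recl big_ord1.
by congr (_ + (u ord0 _ - v ord0 _) ^+ 2); exact: val_inj.
Qed.

(** Stewart's theorem for the segment from [p] to [q] seen from [r]: the flat
    case, with equality, of the inequality [hadamard_cn]. *)
Lemma euclid_dist_stewart (p q r : 'rV[R]_2) (s : R) :
  euclid_dist ((1 - s) *: p + s *: q) r ^+ 2 =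
  (1 - s) * euclid_dist p r ^+ 2 + s * euclid_dist q r ^+ 2
  - s * (1 - s) * euclid_dist p q ^+ 2.
Proof. by rewrite !euclid_dist_sqr !mxE; ring. Qed.

Lemma euclid_distE (u v : 'rV[R]_2) (a : R) : 0 <= a ->
  (u ord0 ord0 - v ord0 ord0) ^+ 2 + (u ord0 ord_max - v ord0 ord_max) ^+ 2
    = a ^+ 2 ->
  euclid_dist u v = a.
Proof.
move=> a0; rewrite -euclid_dist_sqr => /eqP.
by rewrite eqrXn2 ?sqrtr_ge0// => /eqP.
Qed.

(** The comparison triangles that the CAT(0) condition quantifies over must be
    exhibited before that condition says anything. With [p] at the origin and
    [q] on the first axis, [r] has abscissa [h] given by the law of cosines; the
    triangle inequalities say that [`|h| <= b], so an ordinate exists. *)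
Lemma comparison_triangle (a b c : R) : 0 <= a -> 0 <= b -> 0 <= c ->
  a <= b + c -> b <= a + c -> c <= a + b ->
  exists p q r : 'rV[R]_2,
    [/\ euclid_dist p q = a, euclid_dist p r = b & euclid_dist q r = c].
Proof.
move=> a0 b0 c0 abc bac cab.
pose vec (h k : R) : 'rV[R]_2 := \row_i (if i == ord0 then h else k).
have vecx h k : vec h k ord0 ord0 = h by rewrite mxE.
have vecy h k : vec h k ord0 ord_max = k by rewrite mxE.
pose h := (a ^+ 2 + b ^+ 2 - c ^+ 2) / (2 * a).
have hE : 2 * a * h = a ^+ 2 + b ^+ 2 - c ^+ 2.
  have [a_eq0|a_neq0] := eqVneq a 0.
    have bc : b = c by lra.
    by rewrite bc a_eq0; ring.
  by rewrite /h; field.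
have k0 : 0 <= b ^+ 2 - h ^+ 2.
  (* If [a = 0] then [h = 0], because the inverse of 0 is 0. *)
  have [a_eq0|a_neq0] := eqVneq a 0.
    by rewrite /h a_eq0 mulr0 invr0 mulr0 expr0n/= subr0 sqr_ge0.
  have a_gt0 : 0 < a by rewrite lt_neqAle eq_sym a_neq0.
  have h1 : 0 <= b - h by rewrite -(pmulr_rge0 _ a_gt0); nra.
  have h2 : 0 <= b + h by rewrite -(pmulr_rge0 _ a_gt0); nra.
  by rewrite subr_sqr mulr_ge0.
exists (vec 0 0), (vec a 0), (vec h (Num.sqrt (b ^+ 2 - h ^+ 2))).
split; apply: euclid_distE => //; rewrite !vecx !vecy.
- by ring.
- by rewrite !sub0r !sqrrN sqr_sqrtr//; ring.
- by rewrite sub0r sqrrN sqr_sqrtr//; lra.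
Qed.

End euclidean_plane.

Section hadamard.
Context {R : realType} {X : completeMetricType R} (hX : hadamard_space X).

(** Compare with the triangle [p q r], taking one point on the side [p q] and
    the vertex [r] as the endpoint of the side [p r]; the Euclidean distance is
    then known exactly. *)
Lemma hadamard_cn (c : R -> X) (p q r : X) (s : R) :
  geodesic c p q -> 0 <= s <= 1 ->
  mdist r (c s) ^+ 2 <= (1 - s) * mdist r p ^+ 2 + s * mdist r q ^+ 2
                        - s * (1 - s) * mdist p q ^+ 2.
Proof.
move=> cpq s01; have [/(_ p r)[cpr gpr] cat0X] := hX.
have [/(_ q r)[cqr gqr] _] := hX.
have [p' [q' [r' [pq pr qr]]]] : exists p' q' r' : 'rV[R]_2,
    [/\ euclid_dist p' q' = mdist p q, euclid_dist p' r' = mdist p r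
      & euclid_dist q' r' = mdist q r].
  apply: comparison_triangle; rewrite ?mdist_ge0//.
  - by rewrite (metric_sym q r) metric_triangle.
  - exact: metric_triangle.
  - by rewrite (metric_sym p q) metric_triangle.
have one01 : 0 <= (1 : R) <= 1 by rewrite ler01 lexx.
have := cat0X _ _ _ _ _ _ cpq gpr gqr _ _ _ pq pr qr _ _ s01 one01.
have [_ -> _] := gpr.
rewrite subrr scale0r add0r scale1r => csr.
rewrite (metric_sym r p) (metric_sym r q) (metric_sym r) -pq -pr -qr.
rewrite -euclid_dist_stewart lerXn2r ?nnegrE ?mdist_ge0//.
exact: sqrtr_ge0.
Qed.

End hadamard.

(** * Limits in metric spaces and lower semicontinuity *)

Section metric_limits.
Context {R : realType}.

Lemma cvg_mdist {X : metricType R} {T : Type} {F : set_system T}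
    {FF : Filter F} (p l : X) (u : T -> X) :
  u @ F --> l -> mdist p (u n) @[n --> F] --> mdist p l.
Proof.
move=> /metricType_numDomainType.cvgrPdist_lt ul; apply/cvgrPdist_lt => e e0.
near=> n.
have lun : mdist l (u n) < e by near: n; exact: ul.
rewrite ltr_distl; have := metric_triangle p l (u n).
by have := metric_triangle p (u n) l; rewrite (metric_sym (u n)); lra.
Unshelve. all: by end_near. Qed.

Lemma cvgr0_of_expr {T : Type} {F : set_system T} {FF : Filter F}
    (k : nat) (r : T -> R) : (0 < k)%N -> (forall n, 0 <= r n) ->
  r n ^+ k @[n --> F] --> 0 -> r @ F --> 0.
Proof.
move=> k0 r0 /cvgr0Pnorm_lt rk; apply/cvgr0Pnorm_lt => e e0.
near=> n.
have : `|r n ^+ k| < e ^+ k by near: n; apply: rk; rewrite exprn_gt0.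
rewrite !ger0_norm ?exprn_ge0//.
by rewrite ltr_pXn2r ?nnegrE ?(ltW e0)//.
Unshelve. all: by end_near. Qed.

(** The exponent [k] is 2 for minimizing sequences and 4 for the iterated
    resolvents, where the squared distance is controlled by a square root. *)
Lemma cvg_seq_of_mdist_exprn {X : completeMetricType R} (k : nat) (u : nat -> X)
    (r : nat -> R) : (0 < k)%N ->
  (forall n m, (0 < n)%N -> (0 < m)%N -> mdist (u n) (u m) ^+ k <= r n + r m) ->
  r n @[n --> \oo] --> 0 -> cvg (u n @[n --> \oo]).
Proof.
move=> k0 ur /cvgr0Pnorm_lt r0; apply: cauchy_cvg; apply: cauchy_exP => e e0.
have rlt : \forall n \near \oo, `|r n| < e ^+ k / 2.
  by apply: r0; rewrite divr_gt0// exprn_gt0.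
have lt_near n : `|r n| < e ^+ k / 2 -> r n < e ^+ k / 2.
  exact: ltr_normlW.
near \oo => N; exists (u N); rewrite ballEmdist.
suff : \forall n \near \oo, mdist (u N) (u n) < e by [].
near=> n.
suff : mdist (u N) (u n) ^+ k < e ^+ k.
  by rewrite ltr_pXn2r ?nnegrE ?mdist_ge0 ?(ltW e0)//.
apply: (le_lt_trans (ur _ _ _ _)).
- by near: N; exact: nbhs_infty_gt.
- by near: n; exact: nbhs_infty_gt.
rewrite [ltRHS]splitr ltrD//; apply: lt_near.
- by near: N.
- by near: n.
Unshelve. all: by end_near. Qed.

Lemma cvg_invn : (n%:R^-1 : R) @[n --> \oo] --> (0 : R).
Proof.
by rewrite -(cvg_shiftS (fun n => n%:R^-1 : R)); exact: cvg_harmonic.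
Qed.

(** Lower semicontinuity along a filter; the bound [c n] may vary because,
    for minimizing sequences, it involves the distance to the moving point. *)
Lemma lsc_le_lim {X : topologicalType} {T : Type} {F : set_system T}
    {FF : ProperFilter F} (phi : X -> \bar R) (u : T -> X) (l : X)
    (c : T -> R) (a : R) :
  lower_semicontinuous phi -> u @ F --> l -> c @ F --> a ->
  (\forall n \near F, (phi (u n) <= (c n)%:E)%E) -> (phi l <= a%:E)%E.
Proof.
move=> lsc ul ca le_phi; rewrite leNgt; apply/negP => lt_phi.
have [b ab bphi] : exists2 b : R, a < b & (b%:E < phi l)%E.
  case: (phi l) lt_phi => [r| |]//=.
  - rewrite lte_fin => ar; exists ((a + r) / 2); first by rewrite midf_lt.
    by rewrite lte_fin midf_lt.
  - by exists (a + 1); rewrite ?ltrDl ?ltry.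
have [V Vl Vphi] := lsc _ _ bphi.
near F => n.
have : (phi (u n) < b%:E)%E.
  apply: (@le_lt_trans _ _ (c n)%:E); first by near: n.
  by rewrite lte_fin; near: n; exact: cvgr_lt ca _ ab.
have : (b%:E < phi (u n))%E by apply: Vphi; near: n; exact: ul.
by move=> /lt_trans h /h; rewrite ltxx.
Unshelve. all: by end_near. Qed.

End metric_limits.

(** * The resolvent and its variational inequality *)

Section proximal_steps.
Context {R : realType} {X : completeMetricType R} (hX : hadamard_space X).
Context (phi : X -> \bar R) (mu : R).
Hypothesis phi_ge : forall u, (mu%:E <= phi u)%E.
Hypothesis phi_convex : convex_fun phi.
Hypothesis phi_lsc : lower_semicontinuous phi.

Local Notation f u := (fine (phi u)).

Lemma edom_fineK u : edom phi u -> phi u = (f u)%:E.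
Proof.
move=> du; rewrite fineK// fin_numElt; apply/andP; split; last exact: du.
exact: lt_le_trans (ltNyr mu) (phi_ge u).
Qed.

Lemma edom_ge u : edom phi u -> mu <= f u.
Proof. by move=> du; rewrite -lee_fin -edom_fineK. Qed.

Lemma edom_of_le u (a : R) : (phi u <= a%:E)%E -> edom phi u /\ f u <= a.
Proof.
move=> le_a; have du : edom phi u by exact: le_lt_trans le_a (ltry a).
by split=> //; rewrite -lee_fin -edom_fineK.
Qed.

(** The functional minimized by the resolvent, with real values; it is
    meaningful on the domain of [phi], where [phi] is finite. *)
Definition prox_objective (l : R) (x u : X) : R :=
  f u + (2 * l)^-1 * mdist x u ^+ 2.

Lemma prox_objective_strongly_convex (l : R) (x p q : X) (c : R -> X) (s : R) :
  0 < l -> edom phi p -> edom phi q -> geodesic c p q -> 0 <= s <= 1 ->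
  edom phi (c s) /\
  prox_objective l x (c s) <=
    (1 - s) * prox_objective l x p + s * prox_objective l x q
    - s * (1 - s) * ((2 * l)^-1 * mdist p q ^+ 2).
Proof.
move=> l0 dp dq gc s01.
have := phi_convex gc s01; rewrite (edom_fineK dp) (edom_fineK dq).
rewrite -!EFinM -EFinD => /edom_of_le[dc fc]; split=> //.
have i0 : 0 <= (2 * l)^-1 by rewrite invr_ge0 mulr_ge0// ltW.
have := ler_wpM2l i0 (hadamard_cn hX x gc s01).
rewrite /prox_objective; move: (2 * l)^-1 => k hk; lra.
Qed.

(** Strong convexity at the midpoint of two almost minimizers bounds their
    distance, so minimizing sequences are Cauchy and, by lower semicontinuity,
    their limit is a minimizer. *)
Lemma prox_objective_minimizer (l : R) (x : X) : 0 < l -> edom phi !=set0 ->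
  exists2 u, edom phi u &
    forall v, edom phi v -> prox_objective l x u <= prox_objective l x v.
Proof.
move=> l0 [v0 dv0]; pose E := prox_objective l x @` edom phi.
have i0 : 0 <= (2 * l)^-1 by rewrite invr_ge0 mulr_ge0// ltW.
have infE : has_inf E.
  split; first by exists (prox_objective l x v0), v0.
  exists mu => _ [v dv <-]; rewrite (le_trans (edom_ge dv))// lerDl.
  by rewrite mulr_ge0// sqr_ge0.
have le_inf v : edom phi v -> inf E <= prox_objective l x v.
  by move=> dv; apply: ge_inf; [exact: infE.2|exists v].
have /choice[u uP] : forall n : nat, exists v, edom phi v /\
    prox_objective l x v <= inf E + n.+1%:R^-1.
  move=> n.
  have n0 : 0 < n.+1%:R^-1 :> R by rewrite invr_gt0.
  have [_ [v dv <-] /ltW le_v] := inf_adherent n0 infE.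
  by exists v.
have cauchy_u n m : mdist (u n) (u m) ^+ 2 <=
    4 * l * n.+1%:R^-1 + 4 * l * m.+1%:R^-1.
  have [[dn un] [dm um]] := (uP n, uP m).
  have [c gc] := hX.1 (u n) (u m).
  have half01 : 0 <= (2^-1 : R) <= 1 by apply/andP; split; lra.
  have [dc] := prox_objective_strongly_convex x l0 dn dm gc half01.
  have := le_inf _ dc.
  move=> h1 /(le_trans h1) h2.
  have h3 : 2^-1 * ((2 * l)^-1 * mdist (u n) (u m) ^+ 2) <=
      n.+1%:R^-1 + m.+1%:R^-1.
    move: h2 un um; move: (n.+1%:R^-1) (m.+1%:R^-1).
    move: (prox_objective _ _ _) (prox_objective _ _ _) => p q a b.
    by lra.
  have l4 : 0 <= 4 * l by lra.
  have := ler_wpM2l l4 h3; rewrite mulrDr; apply: le_trans.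
  suff -> : 4 * l * (2^-1 * ((2 * l)^-1 * mdist (u n) (u m) ^+ 2)) =
    mdist (u n) (u m) ^+ 2 by [].
  by field; lra.
have harm : n.+1%:R^-1 @[n --> \oo] --> (0 : R) by exact: cvg_harmonic.
have harm4 : 4 * l * n.+1%:R^-1 @[n --> \oo] --> (0 : R).
  by rewrite -(mulr0 (4 * l)); apply: cvgM harm; exact: cvg_cst.
have /cvg_ex[/= w uw] : cvg (u n @[n --> \oo]).
  apply: (@cvg_seq_of_mdist_exprn _ _ 2 _ _ isT _ harm4) => n m _ _.
  exact: cauchy_u.
have phi_w : (phi w <= (inf E + 0 - (2 * l)^-1 * mdist x w ^+ 2)%:E)%E.
  pose c n := inf E + n.+1%:R^-1 - (2 * l)^-1 * mdist x (u n) ^+ 2.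
  apply: (@lsc_le_lim _ _ _ _ _ phi u w c _ phi_lsc uw).
    apply: cvgB; first by apply: cvgD harm; exact: cvg_cst.
    apply: cvgM; first exact: cvg_cst.
    by rewrite expr2; apply: cvgM; exact: cvg_mdist.
  near=> n; have [dn un] := uP n; rewrite (edom_fineK dn) lee_fin /c.
  by move: un; rewrite /prox_objective; move: (n.+1%:R^-1) => a; lra.
have [dw fw] := edom_of_le phi_w.
exists w => // v dv; apply: le_trans (le_inf v dv).
by move: fw; rewrite /prox_objective; lra.
Unshelve. all: by end_near. Qed.

Lemma resolvent_min (l : R) (x : X) : 0 < l -> edom phi !=set0 ->
  edom phi (resolvent phi l x) /\
  forall v, edom phi v ->
    prox_objective l x (resolvent phi l x) <= prox_objective l x v.
Proof.
move=> l0 dom0; rewrite /resolvent l0.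
set A := argmin _.
have [u du umin] := prox_objective_minimizer x l0 dom0.
have /(@getPex _ A) Aget : exists u, A u.
  exists u => v; have [dv|] := ltP (phi v) +oo%E; last first.
    by rewrite leye_eq => /eqP ->; rewrite addye// leey.
  rewrite (edom_fineK du) (edom_fineK dv) -!EFinD lee_fin.
  exact: umin.
have dget : edom phi (get A).
  rewrite /edom/= ltNge leye_eq; apply/negP => /eqP phi_get.
  have := Aget u; rewrite phi_get addye// leye_eq (edom_fineK du).
  by rewrite -EFinD.
split=> // v dv; have := Aget v.
by rewrite (edom_fineK dget) (edom_fineK dv) -!EFinD lee_fin.
Qed.

(** Along the geodesic from the minimizer [u] to [v], strong convexity and
    minimality give, after division by the parameter [s > 0], an inequality
    whose limit as [s] tends to 0 is the claim multiplied by [(2 l)^-1]. *)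
Lemma resolvent_evi (l : R) (x v : X) : 0 < l -> edom phi v ->
  mdist (resolvent phi l x) v ^+ 2 + mdist x (resolvent phi l x) ^+ 2
  + 2 * l * (f (resolvent phi l x) - f v) <= mdist x v ^+ 2.
Proof.
move=> l0 dv.
have [] := resolvent_min x l0 (ex_intro _ v dv).
move: (resolvent phi l x) => u du umin.
have [c gc] := hX.1 u v.
have i0 : 0 < 2 * l by lra.
have near_u s : 0 < s < 1 -> prox_objective l x u
    + (1 - s) * ((2 * l)^-1 * mdist u v ^+ 2) <= prox_objective l x v.
  move=> /andP[s0 s1].
  have s01 : 0 <= s <= 1 by rewrite !ltW.
  have [dc] := prox_objective_strongly_convex x l0 du dv gc s01.
  move=> /(le_trans (umin _ dc)) h.
  by rewrite -(ler_pM2l s0); lra.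
have lim_u : prox_objective l x u + (2 * l)^-1 * mdist u v ^+ 2
    <= prox_objective l x v.
  set d := (2 * l)^-1 * mdist u v ^+ 2 in near_u *.
  have d0 : 0 <= d by rewrite mulr_ge0 ?sqr_ge0// invr_ge0 ltW.
  apply/ler_addgt0Pr => e e0.
  (* This parameter makes the error term [s * d] at most [e]. *)
  have s01 : 0 < e / (1 + d + e) < 1.
    by rewrite divr_gt0/= ?ltr_pdivrMr; lra.
  have := near_u _ s01.
  have : e / (1 + d + e) * d <= e.
    by rewrite mulrAC ler_pdivrMr; nra.
  by lra.
have := ler_wpM2l (ltW i0) lim_u.
rewrite /prox_objective !mulrDr !mulrA divff ?gt_eqF// !mul1r.
by lra.
Qed.

End proximal_steps.

(** * Convergence of the iterated resolvents to the gradient flow *)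

Section kobayashi_bound.
Context {R : realType}.

(** Concavity of the square root: the arguments on the left have weighted mean
    [w], since the terms in [d] cancel. *)
Lemma sqrt_concave_comb (l m d w : R) : 0 < l -> 0 < m ->
  0 <= w - 2 * d * l -> 0 <= w + 2 * d * m ->
  m * Num.sqrt (w - 2 * d * l) + l * Num.sqrt (w + 2 * d * m)
    <= (l + m) * Num.sqrt w.
Proof.
move=> l0 m0 h1 h2.
have w0 : 0 <= w by rewrite -(pmulr_rge0 _ (addr_gt0 l0 m0)); nra.
have := sqr_sqrtr h1; have := sqr_sqrtr h2; have := sqr_sqrtr w0.
have := sqrtr_ge0 (w - 2 * d * l); have := sqrtr_ge0 (w + 2 * d * m).
have := sqrtr_ge0 w.
move: (Num.sqrt w) (Num.sqrt (w + 2 * d * m)) (Num.sqrt (w - 2 * d * l)).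
move=> z q p z0 q0 p0 zz qq pp.
have lm0 : 0 <= l * m by rewrite mulr_ge0// ltW.
rewrite -(@ler_pXn2r _ 2) ?nnegrE//; last 2 first.
- by rewrite addr_ge0// mulr_ge0// ltW.
- by rewrite mulr_ge0// addr_ge0// ltW.
rewrite exprMn zz.
have -> : (l + m) ^+ 2 * w = (l + m) * (m * p ^+ 2 + l * q ^+ 2).
  by rewrite pp qq; ring.
rewrite -subr_ge0.
have -> : (l + m) * (m * p ^+ 2 + l * q ^+ 2) - (m * p + l * q) ^+ 2 =
  l * m * (p - q) ^+ 2 by ring.
by rewrite mulr_ge0// sqr_ge0.
Qed.

(** Let [w i j] be the radicand and [d = i l - j m]. Then
    [w (i - 1) j = w i j - 2 d l] and [w i (j - 1) = w i j + 2 d m], so by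
    concavity the square root of [w] is a supersolution of the recursion, and
    it dominates the boundary values since [w i 0 >= (i l)^2]. *)
Lemma kobayashi_bound (a : nat -> nat -> R) (l m C : R) :
  0 < l -> 0 < m -> 0 <= C ->
  (forall i, a i 0%N <= C * (i%:R * l)) ->
  (forall j, a 0%N j <= C * (j%:R * m)) ->
  (forall i j, (l + m) * a i.+1 j.+1 <= m * a i j.+1 + l * a i.+1 j) ->
  forall i j, a i j <= C * Num.sqrt ((i%:R * l - j%:R * m) ^+ 2
                                     + i%:R * l ^+ 2 + j%:R * m ^+ 2).
Proof.
move=> l0 m0 C0 ai0 a0j rec.
have lm0 : 0 < l + m by exact: addr_gt0.
have w0 i j : 0 <= (i%:R * l - j%:R * m) ^+ 2 + i%:R * l ^+ 2 + j%:R * m ^+ 2.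
  by rewrite !addr_ge0 ?sqr_ge0// mulr_ge0 ?sqr_ge0.
elim=> [j|i IHi].
  apply: (le_trans (a0j j)); apply: ler_wpM2l => //.
  have j0 : 0 <= j%:R * m by rewrite mulr_ge0// ltW.
  rewrite -[leLHS]ger0_norm// -sqrtr_sqr ler_wsqrtr//.
  by rewrite !mul0r sub0r sqrrN addr0 lerDl mulr_ge0 ?sqr_ge0.
elim=> [|j IHj].
  apply: (le_trans (ai0 _)); apply: ler_wpM2l => //.
  have i0 : 0 <= i.+1%:R * l by rewrite mulr_ge0// ltW.
  rewrite -[leLHS]ger0_norm// -sqrtr_sqr ler_wsqrtr//.
  by rewrite !mul0r subr0 addr0 lerDl mulr_ge0 ?sqr_ge0.
rewrite -(ler_pM2l lm0); apply: (le_trans (rec i j)).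
have := ler_wpM2l (ltW m0) (IHi j.+1); have := ler_wpM2l (ltW l0) IHj.
set w := (X in _ -> _ -> _ <= _ * (C * Num.sqrt X)).
pose d : R := i.+1%:R * l - j.+1%:R * m.
have -> : (i%:R * l - j.+1%:R * m) ^+ 2 + i%:R * l ^+ 2 + j.+1%:R * m ^+ 2
    = w - 2 * d * l by rewrite /w /d -!(natr1 i) -!(natr1 j); ring.
have -> : (i.+1%:R * l - j%:R * m) ^+ 2 + i.+1%:R * l ^+ 2 + j%:R * m ^+ 2
    = w + 2 * d * m by rewrite /w /d -!(natr1 i) -!(natr1 j); ring.
(* [w - 2 * d * l] and [w + 2 * d * m] are themselves values of [w]. *)
have wl : 0 <= w - 2 * d * l.
  have -> : w - 2 * d * l =
    (i%:R * l - j.+1%:R * m) ^+ 2 + i%:R * l ^+ 2 + j.+1%:R * m ^+ 2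
    by rewrite /w /d -!(natr1 i) -!(natr1 j); ring.
  exact: w0.
have wm : 0 <= w + 2 * d * m.
  have -> : w + 2 * d * m =
    (i.+1%:R * l - j%:R * m) ^+ 2 + i.+1%:R * l ^+ 2 + j%:R * m ^+ 2
    by rewrite /w /d -!(natr1 i) -!(natr1 j); ring.
  exact: w0.
have := ler_wpM2l C0 (sqrt_concave_comb l0 m0 wl wm).
by lra.
Qed.

End kobayashi_bound.

Section gradient_flow.
Context {R : realType} {X : completeMetricType R} (hX : hadamard_space X).
Context (phi : X -> \bar R) (mu : R).
Hypothesis phi_ge : forall u, (mu%:E <= phi u)%E.
Hypothesis phi_convex : convex_fun phi.
Hypothesis phi_lsc : lower_semicontinuous phi.
Context (x : X) (dx : edom phi x).

Local Notation f u := (fine (phi u)).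
Local Notation prox l i := (iter i (resolvent phi l) x).

Let evi := resolvent_evi hX phi_ge phi_convex phi_lsc.

Lemma prox_iter_edom (l : R) (i : nat) : 0 < l -> edom phi (prox l i).
Proof.
move=> l0; case: i => [//|i].
by case: (resolvent_min hX phi_ge phi_convex phi_lsc (prox l i) l0
  (ex_intro _ x dx)).
Qed.

(** Test the variational inequality at the current iterate. *)
Lemma prox_iter_nonincreasing (l : R) (i : nat) : 0 < l ->
  f (prox l i.+1) <= f (prox l i).
Proof.
move=> l0; have := evi (prox l i) l0 (prox_iter_edom i l0).
rewrite mdistxx expr0n/= => h; rewrite -(@ler_pM2l _ (2 * l)) ?mulr_gt0//.
have := sqr_ge0 (mdist (prox l i.+1) (prox l i)).
have := sqr_ge0 (mdist (prox l i) (prox l i.+1)).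
by move: h; rewrite /=; lra.
Qed.

(** Summing the variational inequalities tested at [z] telescopes the
    distances, and the last value of [phi] is the smallest. *)
Lemma prox_iter_gap (l : R) (i : nat) (z : X) : 0 < l -> edom phi z ->
  2 * (i%:R * l) * (f (prox l i) - f z) + mdist (prox l i) z ^+ 2
    <= mdist x z ^+ 2.
Proof.
move=> l0 dz; elim: i => [|i IH]; first by rewrite /= !(mul0r, mulr0) add0r.
have := evi (prox l i) l0 dz; rewrite -iterS.
have := sqr_ge0 (mdist (prox l i) (prox l i.+1)).
have il0 : 0 <= 2 * (i%:R * l) by rewrite !mulr_ge0// ltW.
have := ler_wpM2l il0 (prox_iter_nonincreasing i l0).
by rewrite -natr1; lra.
Qed.

(** Boundary values for Kobayashi's bound, from the variational inequality
    tested at the starting point [x]. *)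
Lemma prox_iter_mdist_start (l : R) (i : nat) : 0 < l ->
  mdist (prox l i) x ^+ 2 <= 2 * (f x - mu) * (i%:R * l).
Proof.
move=> l0; elim: i => [|i IH]; first by rewrite /= mdistxx expr0n/= mul0r mulr0.
have := evi (prox l i) l0 dx; rewrite -iterS.
have := sqr_ge0 (mdist (prox l i) (prox l i.+1)).
have := ler_wpM2l (ltW l0) (edom_ge phi_ge (prox_iter_edom i.+1 l0)).
by rewrite -natr1; lra.
Qed.

Lemma prox_iter_fejer (l : R) (i j : nat) (z : X) : 0 < l -> argmin phi z ->
  (i <= j)%N -> mdist (prox l j) z <= mdist (prox l i) z.
Proof.
move=> l0 az; have dz : edom phi z by apply: le_lt_trans (az x) dx.
have step k : mdist (prox l k.+1) z <= mdist (prox l k) z.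
  rewrite -(@ler_pXn2r _ 2) ?nnegrE ?mdist_ge0//.
  have := evi (prox l k) l0 dz; rewrite -iterS.
  have := sqr_ge0 (mdist (prox l k) (prox l k.+1)).
  have : 0 <= l * (f (prox l k.+1) - f z).
    apply: mulr_ge0; [exact: ltW|rewrite subr_ge0 -lee_fin].
    by rewrite -!(edom_fineK phi_ge)//; exact: prox_iter_edom.
  by lra.
elim: j => [|j IH]; first by rewrite leqn0 => /eqP ->.
by rewrite leq_eqVlt => /predU1P[->//|/IH]; exact: le_trans.
Qed.

(** Each scheme is tested at the current point of the other one; weighting the
    two inequalities by the step sizes cancels the values of [phi]. *)
Lemma prox_iter_mdist (l m : R) (i j : nat) : 0 < l -> 0 < m ->
  mdist (prox l i) (prox m j) ^+ 2 <=
    2 * (f x - mu) * Num.sqrt ((i%:R * l - j%:R * m) ^+ 2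
                               + i%:R * l ^+ 2 + j%:R * m ^+ 2).
Proof.
move=> l0 m0; apply: (kobayashi_bound
  (a := fun i j => mdist (prox l i) (prox m j) ^+ 2)) => //.
- by rewrite mulr_ge0// subr_ge0 (edom_ge phi_ge).
- by move=> k; exact: prox_iter_mdist_start.
- by move=> k; rewrite metric_sym; exact: prox_iter_mdist_start.
move=> {}i {}j.
have := evi (prox l i) l0 (prox_iter_edom j.+1 m0).
have := evi (prox m j) m0 (prox_iter_edom i.+1 l0).
rewrite -!iterS => hm hl.
have sm := sqr_ge0 (mdist (prox m j) (prox m j.+1)).
have sl := sqr_ge0 (mdist (prox l i) (prox l i.+1)).
have {hm sm} : mdist (prox l i.+1) (prox m j.+1) ^+ 2 +
    2 * m * (f (prox m j.+1) - f (prox l i.+1)) <=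
    mdist (prox l i.+1) (prox m j) ^+ 2.
  by rewrite (metric_sym (prox l i.+1)) (metric_sym (prox l i.+1)); lra.
move=> /(ler_wpM2l (ltW l0)).
have {hl sl} : mdist (prox l i.+1) (prox m j.+1) ^+ 2 +
    2 * l * (f (prox l i.+1) - f (prox m j.+1)) <=
    mdist (prox l i) (prox m j.+1) ^+ 2 by lra.
move=> /(ler_wpM2l (ltW m0)).
by lra.
Qed.

Lemma prox_iter_mdist4 (l m : R) (i j : nat) : 0 < l -> 0 < m ->
  mdist (prox l i) (prox m j) ^+ 4 <=
    (2 * (f x - mu)) ^+ 2 * ((i%:R * l - j%:R * m) ^+ 2
                              + i%:R * l ^+ 2 + j%:R * m ^+ 2).
Proof.
move=> l0 m0.
have w0 : 0 <= (i%:R * l - j%:R * m) ^+ 2 + i%:R * l ^+ 2 + j%:R * m ^+ 2.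
  by rewrite !addr_ge0 ?sqr_ge0// mulr_ge0 ?sqr_ge0.
rewrite -(sqr_sqrtr w0) -exprMn (exprM _ 2 2).
apply: lerXn2r; rewrite ?nnegrE ?sqr_ge0//; last exact: prox_iter_mdist.
by rewrite !mulr_ge0 ?sqrtr_ge0// subr_ge0 (edom_ge phi_ge).
Qed.

(** For two discretizations of the same time, [i l = j m] and Kobayashi's bound
    is of order [n^-1 + m^-1] after squaring. *)
Lemma gradient_flow_cvg (t : R) : 0 < t ->
  prox (t / n%:R) n @[n --> \oo] --> gradient_flow phi t x.
Proof.
move=> t0; pose K := (2 * (f x - mu)) ^+ 2 * t ^+ 2.
have K0 : K * n%:R^-1 @[n --> \oo] --> (0 : R).
  by rewrite -(mulr0 K); apply: cvgM cvg_invn; exact: cvg_cst.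
apply: (cvg_seq_of_mdist_exprn (k := 4) _ _ K0) => // n m n0 m0.
have {}n0 : 0 < n%:R :> R by rewrite ltr0n.
have {}m0 : 0 < m%:R :> R by rewrite ltr0n.
apply: (le_trans (prox_iter_mdist4 _ _ (divr_gt0 t0 n0) (divr_gt0 t0 m0))).
suff -> : (2 * (f x - mu)) ^+ 2 * ((n%:R * (t / n%:R) - m%:R * (t / m%:R)) ^+ 2
    + n%:R * (t / n%:R) ^+ 2 + m%:R * (t / m%:R) ^+ 2) =
    K / n%:R + K / m%:R by [].
by rewrite /K; field; rewrite !gt_eqF.
Qed.

Lemma gradient_flow_gap (t : R) (y : X) : 0 < t -> edom phi y ->
  (phi (gradient_flow phi t x) <= (f y + mdist x y ^+ 2 / (2 * t))%:E)%E.
Proof.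
move=> t0 dy.
apply: (lsc_le_lim phi_lsc (gradient_flow_cvg t0) (cvg_cst _)).
near=> n.
have n0 : 0 < n%:R :> R by rewrite ltr0n; near: n; exact: nbhs_infty_gt.
have tn0 := divr_gt0 t0 n0.
rewrite (edom_fineK phi_ge (prox_iter_edom n tn0)) lee_fin -lerBlDl.
rewrite ler_pdivlMr; last by rewrite mulr_gt0.
have := prox_iter_gap n tn0 dy.
rewrite [_ * (t / _)]mulrC divfK ?gt_eqF//.
have := sqr_ge0 (mdist (prox (t / n%:R) n) y).
by lra.
Unshelve. all: by end_near. Qed.

Lemma gradient_flow_mdist_start (t : R) (z : X) : 0 < t -> argmin phi z ->
  mdist (gradient_flow phi t x) z <= mdist x z.
Proof.
move=> t0 az; rewrite metric_sym.
apply: (cvgr_to_le (cvg_mdist (gradient_flow_cvg t0))).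
near=> n; rewrite metric_sym.
have n0 : 0 < n%:R :> R by rewrite ltr0n; near: n; exact: nbhs_infty_gt.
exact: (prox_iter_fejer (divr_gt0 t0 n0) az (leq0n n)).
Unshelve. all: by end_near. Qed.

(** After [k n = floor (s n / t)] of its [n] steps, the scheme for time [t] has
    run for a time within [t / n] of [s], so by Kobayashi's bound it is close
    to the scheme for time [s]; its remaining steps do not increase the
    distance to [z]. *)
Lemma gradient_flow_fejer (s t : R) (z : X) : 0 < s -> s <= t ->
  argmin phi z ->
  mdist (gradient_flow phi t x) z <= mdist (gradient_flow phi s x) z.
Proof.
move=> s0 st az; have t0 := lt_le_trans s0 st.
pose k n := Num.truncn (s * n%:R / t).
pose r n := mdist (prox (t / n%:R) (k n)) (prox (s / n%:R) n).
pose K := (2 * (f x - mu)) ^+ 2 * (t ^+ 2 + s * t + s ^+ 2).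
have k_itv n : (k n)%:R <= s * n%:R / t < (k n).+1%:R.
  by apply: truncn_itv; rewrite divr_ge0 ?mulr_ge0// ltW.
have k_le n : (k n <= n)%N.
  rewrite -(ler_nat R); have /andP[/le_trans h _] := k_itv n; apply: h.
  by rewrite ler_pdivrMr// mulrC ler_wpM2l.
have rK n : (0 < n)%N -> r n ^+ 4 <= K * n%:R^-1.
  move=> n_gt0; have n0 : 0 < n%:R :> R by rewrite ltr0n.
  apply: (le_trans (prox_iter_mdist4 _ _ (divr_gt0 t0 n0) (divr_gt0 s0 n0))).
  rewrite /K -[leRHS]mulrA; apply: ler_wpM2l; first exact: sqr_ge0.
  rewrite [_ * (s / _)]mulrC divfK ?gt_eqF//.
  have /andP[] := k_itv n; rewrite ler_pdivlMr// ltr_pdivrMr// -natr1.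
  have : 0 < n%:R^-1 :> R by rewrite invr_gt0.
  have : n%:R^-1 <= 1 :> R by rewrite invf_le1// ler1n.
  have : n%:R * n%:R^-1 = 1 :> R by rewrite divff ?gt_eqF.
  (* [q] stands for the number of steps [k n], and [v] for [n^-1]. *)
  move: (k n)%:R n%:R^-1 => q v nv v1 v0 qs sq.
  have qv : q * (t * v) <= s.
    have := ler_wpM2r (ltW v0) qs.
    by rewrite -mulrA -[s * _ * v]mulrA nv mulr1 mulrA.
  have vq : s <= q * (t * v) + t * v.
    have := ler_wpM2r (ltW v0) (ltW sq).
    by rewrite -[s * _ * v]mulrA nv mulr1; lra.
  have tv0 : 0 <= t * v by rewrite mulr_ge0// ltW.
  have sq_le : (q * (t * v) - s) ^+ 2 <= t ^+ 2 * v.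
    apply: (@le_trans _ _ ((t * v) ^+ 2)).
      rewrite -sqrrN ler_pXn2r ?nnegrE//; lra.
    by rewrite exprMn ler_wpM2l ?sqr_ge0// expr2 ler_piMl// ltW.
  have := ler_wpM2r tv0 qv.
  have -> : n%:R * (s * v) ^+ 2 = (n%:R * v) * (s ^+ 2 * v) by ring.
  rewrite nv mul1r.
  by lra.
have r0 : r @ \oo --> 0.
  apply: (@cvgr0_of_expr _ _ _ _ 4) => // [n|]; first exact: mdist_ge0.
  have K0 : K * n%:R^-1 @[n --> \oo] --> (0 : R).
    by rewrite -(mulr0 K); apply: cvgM cvg_invn; exact: cvg_cst.
  apply: squeeze_cvgr (cvg_cst 0) K0; near=> n.
  rewrite exprn_ge0 ?mdist_ge0//=; apply: rK.
  by near: n; exact: nbhs_infty_gt.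
rewrite metric_sym (metric_sym (gradient_flow phi s x)).
have lim_s : r n + mdist z (prox (s / n%:R) n) @[n --> \oo] -->
    mdist z (gradient_flow phi s x).
  rewrite -[X in _ --> X]add0r.
  exact: cvgD r0 (cvg_mdist (gradient_flow_cvg s0)).
apply: (ler_cvg_to (cvg_mdist (gradient_flow_cvg t0)) lim_s).
near=> n.
have n0 : 0 < n%:R :> R by rewrite ltr0n; near: n; exact: nbhs_infty_gt.
have := prox_iter_fejer (divr_gt0 t0 n0) az (k_le n).
have := metric_triangle (prox (t / n%:R) (k n)) (prox (s / n%:R) n) z.
rewrite !(metric_sym z) => h1 /le_trans; apply.
exact: h1.
Unshelve. all: by end_near. Qed.

End gradient_flow.

(** * Rate of convergence *)

Lemma argmin_ereal_inf (R : realType) (X : metricType R) (phi : X -> \bar R)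
    (y : X) : argmin phi y -> ereal_inf (range phi) = phi y.
Proof.
move=> hy; apply/eqP; rewrite eq_le; apply/andP; split.
  by apply: ereal_inf_lbound; exists y.
by apply: le_ereal_inf_tmp => _ [u _ <-]; exact: hy.
Qed.

Lemma zer_restricted_gap_argmin (R : realType) (X : metricType R)
    (phi : X -> \bar R) (y z : X) (b : R) : argmin phi y ->
  phi y \is a fin_num -> zer (restricted_gap phi y b) z -> argmin phi z.
Proof.
move=> hy fy; rewrite /zer/= /restricted_gap (argmin_ereal_inf hy).
case: ifP => // _ gap0; suff zy : phi z = phi y by move=> u; rewrite zy.
move: gap0 fy; case: (phi z) (phi y) => [p| |] [q| |]//.
by rewrite -EFinB => -[/subr0_eq ->].
Qed.

Unset Implicit Arguments.
Set Strict Implicit.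
Set Printing Implicit Defensive.

Theorem theorem4p35 (R : realType) (X : completeMetricType R)
    (hX : hadamard_space X)
    (phi : X -> \bar R)
    (phi_ninfty : forall u, (-oo < phi u)%E)
    (phi_convex : convex_fun phi)
    (phi_lsc : lower_semicontinuous phi)
    (y x : X) (b : nat) (tau : R -> R)
    (hy : argmin phi y)
    (hx : edom phi x)
    (hb : (1 <= b)%N)
    (hxy : mdist x y <= b%:R)
    (htau : modulus_of_regularity (restricted_gap phi y b%:R)
              (cball y b%:R) tau) :
  let flow := gradient_flow phi in
  let rho := rate b%:R tau in
  [/\ forall e t : R, 0 < e -> rho e <= t ->
        (dist_set (flow t x) (argmin phi) < e%:E)%E,
      forall e t s : R, 0 < e -> rho (e / 2) <= t -> rho (e / 2) <= s ->
        mdist (flow t x) (flow s x) < e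
    & exists xstar : X,
        [/\ argmin phi xstar,
            flow t x @[t --> +oo] --> xstar
          & forall e t : R, 0 < e -> rho (e / 2) <= t ->
              mdist (flow t x) xstar <= e]].
Proof.
move=> flow rho; have [tau_gt0 tauP] := htau.
have dy : edom phi y by exact: le_lt_trans (hy x) hx.
have phi_y : phi y = (fine (phi y))%:E.
  by rewrite fineK// fin_numElt phi_ninfty.
have phi_ge u : ((fine (phi y))%:E <= phi u)%E by rewrite -phi_y.
have gap t (t0 : 0 < t) :=
  gradient_flow_gap hX phi_ge phi_convex phi_lsc hx t0 dy.
have fejer s t z (s0 : 0 < s) (st : s <= t) (az : argmin phi z) :=
  gradient_flow_fejer hX phi_ge phi_convex phi_lsc hx s0 st az.
have rho_ge e : 0 < e -> b%:R ^+ 2 / tau e + 1 <= rho e.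
  by move=> e0; rewrite lerD2r Num.Theory.ceil_ge.
have rho_gt0 e : 0 < e -> 0 < rho e.
  move=> e0; apply: lt_le_trans (rho_ge e e0).
  by rewrite ltr_wpDl// divr_ge0 ?sqr_ge0// ltW// tau_gt0.
have near_min e t : 0 < e -> rho e <= t ->
    exists2 z, argmin phi z & mdist (flow t x) z < e.
  move=> e0 ret; have t0 := lt_le_trans (rho_gt0 e e0) ret.
  have ball_t : cball y b%:R (flow t x).
    rewrite /cball/= metric_sym; apply: le_trans hxy.
    exact: (gradient_flow_mdist_start hX phi_ge phi_convex phi_lsc hx t0 hy).
  have dom_t : edom phi (flow t x) by exact: le_lt_trans (gap t t0) (ltry _).
  (* [b^2 / tau e <= t - 1] makes the gap at most [b^2 / 2t < tau e]. *)
  have gap_lt : (restricted_gap phi y b%:R (flow t x) < (tau e)%:E)%E.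
    rewrite /restricted_gap mem_set; last by split => //; exact: subset_closure.
    rewrite (argmin_ereal_inf hy) phi_y lteBlDr//.
    apply: (le_lt_trans (gap t t0)); rewrite -EFinD lte_fin addrC ltrD2r.
    rewrite ltr_pdivrMr ?mulr_gt0//.
    have te0 := tau_gt0 e e0.
    have := le_trans (rho_ge e e0) ret; rewrite -lerBrDr ler_pdivrMr//.
    have : mdist x y ^+ 2 <= b%:R ^+ 2 by rewrite lerXn2r ?nnegrE ?mdist_ge0.
    have := mulr_gt0 te0 t0.
    by lra.
  have /ereal_inf_lt[_ [z zF <-] uz] := tauP e _ e0 ball_t gap_lt.
  exists z => //; apply: (@zer_restricted_gap_argmin _ _ phi y z b%:R hy _ zF).
  by rewrite phi_y.
have cauchy e t s : 0 < e -> rho (e / 2) <= t -> rho (e / 2) <= s ->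
    mdist (flow t x) (flow s x) < e.
  move=> e0 ret res; have e20 : 0 < e / 2 by rewrite divr_gt0.
  have [z az uz] := near_min _ _ e20 (lexx _).
  rewrite [ltRHS]splitr; apply: le_lt_trans (metric_triangle _ z _) _.
  rewrite (metric_sym z).
  by apply: ltrD; apply: le_lt_trans uz; exact: fejer (rho_gt0 _ e20) _ az.
split=> //.
  move=> e t e0 ret; have [z az uz] := near_min _ _ e0 ret.
  apply: le_lt_trans (_ : _ <= (mdist (flow t x) z)%:E)%E _.
    by apply: ereal_inf_lbound; exists z.
  by rewrite lte_fin.
have /cvg_ex[/= xstar flow_xstar] : cvg (flow t x @[t --> +oo]).
  apply: cauchy_cvg; apply: cauchy_exP => e e0.
  exists (flow (rho (e / 2)) x); rewrite ballEmdist.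
  suff : \forall t \near +oo, mdist (flow (rho (e / 2)) x) (flow t x) < e by [].
  by near=> t; apply: cauchy.
exists xstar; split=> //.
  move=> u; apply: le_trans (phi_ge u); apply/lee_addgt0Pr => e e0.
  apply: (lsc_le_lim phi_lsc flow_xstar (cvg_cst _)); near=> t.
  have t0 : 0 < t by [].
  apply: (le_trans (gap t t0)); rewrite lee_fin lerD2l ler_pdivrMr ?mulr_gt0//.
  have : mdist x y ^+ 2 / (2 * e) <= t by [].
  by rewrite ler_pdivrMr ?mulr_gt0//; lra.
move=> e t e0 ret.
apply: (cvgr_to_le (cvg_mdist (p := flow t x) flow_xstar)).
by near=> s; apply/ltW/cauchy.
Unshelve. all: by end_near. Qed.
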